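(* Let $R=\begin{pmatrix}A & M\\ N & B\end{pmatrix}$ be a Morita context ring such that $MN\subseteq J(A)$ and $NM\subseteq J(B)$. Then $R$ is a 2-$\Delta U$ ring if and only if both $A$ and $B$ are 2-$\Delta U$ rings.
   Context: Rings are associative with identity, not necessarily commutative. $U(R)$ is the group of units of $R$ and $J(R)$ the Jacobson radical. $\Delta(R)=\{r\in R : r+U(R)\subseteq U(R)\}$. A ring $R$ is called 2-$\Delta U$ if $u^2\in 1+\Delta(R)$ for every $u\in U(R)$. Morita context ring: $A,B$ are rings, $M$ is an $(A,B)$-bimodule, $N$ is a $(B,A)$-bimodule, and $\phi:M\otimes_B N\to A$, $\psi:N\otimes_A M\to B$ are bimodule homomorphisms satisfying $\mathrm{Id}_M\otimes_B\psi=\phi\otimes_A\mathrm{Id}_M$ and $\mathrm{Id}_N\otimes_A\phi=\psi\otimes_B\mathrm{Id}_N$ (that is, with $mn:=\phi(m\otimes n)$ and $nm:=\psi(n\otimes m)$, one has $m(nm')=(mn)m'$ and $n(mn')=(nm)n'$). Then the set of matrices $\begin{pmatrix}a & m\\ n & b\end{pmatrix}$ with $a\in A$, $m\in M$, $n\in N$, $b\in B$ is an associative ring under the obvious matrix operations. $MN:=\operatorname{Im}\phi$ and $NM:=\operatorname{Im}\psi$ are the trace ideals, two-sided ideals of $A$ and $B$ respectively. *)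

(* Defs.v *)
From HB Require Import structures.
From mathcomp Require Import all_boot all_algebra.
From mathcomp Require Import boolp classical_sets.

Set Implicit Arguments.
Unset Strict Implicit.
Unset Printing Implicit Defensive.

Import GRing.Theory.
Local Open Scope ring_scope.
Local Open Scope classical_set_scope.

(* Rings are [pzRingType]s: associative, unital, possibly noncommutative and
   possibly zero.  Units are defined propositionally since [unitRingType] would
   add decidable units and a total inverse to the structure. *)
Definition units (R : pzRingType) : set R :=
  [set u | exists v : R, u * v = 1 /\ v * u = 1].

Definition left_ideal (R : pzRingType) (I : set R) : Prop :=
  [/\ I 0,
      forall x y, I x -> I y -> I (x + y)
    & forall a x, I x -> I (a * x)].

Definition maximal_left_ideal (R : pzRingType) (I : set R) : Prop :=
  [/\ left_ideal I, I <> setT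
    & forall K : set R, left_ideal K -> I `<=` K -> K = I \/ K = setT].

(* Intersection of all maximal left ideals (the whole ring if there is none,
   i.e. for the zero ring). *)
Definition jacobson (R : pzRingType) : set R :=
  [set x | forall I : set R, maximal_left_ideal I -> I x].

Definition Delta (R : pzRingType) : set R :=
  [set r | forall u, units u -> units (r + u)].

Definition two_DeltaU (R : pzRingType) : Prop :=
  forall u : R, units u -> exists2 d, Delta d & u ^+ 2 = 1 + d.

Arguments units : clear implicits.
Arguments jacobson : clear implicits.
Arguments Delta : clear implicits.

(* An (A, B)-bimodule: a left A-module with a unital right B-action commuting
   with the left one. *)
Record bimodule (A B : pzRingType) := Bimodule {
  bimodule_lmod :> lmodType A;
  ract : bimodule_lmod -> B -> bimodule_lmod;
  ractDl : forall m m' b, ract (m + m') b = ract m b + ract m' b;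
  ractDr : forall m b b', ract m (b + b') = ract m b + ract m b';
  ractA : forall m b b', ract m (b * b') = ract (ract m b) b';
  ract1 : forall m, ract m 1 = m;
  ractZ : forall a m b, ract (a *: m) b = a *: ract m b
}.

Notation "m <*: b" := (ract m b) (at level 40, left associativity) : ring_scope.

(* Bimodule homomorphisms M (x)_B N -> A, presented as B-balanced biadditive
   maps M x N -> A that are A-linear on both sides: [f m n] is the value at
   the pure tensor m (x) n. *)
Record balanced_bilinear (A B : pzRingType)
    (M : bimodule A B) (N : bimodule B A) (f : M -> N -> A) : Prop := {
  bal_addl : forall m m' n, f (m + m') n = f m n + f m' n;
  bal_addr : forall m n n', f m (n + n') = f m n + f m n';
  bal_mid : forall m b n, f (m <*: b) n = f m (b *: n);
  bal_scalel : forall a m n, f (a *: m) n = a * f m n;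
  bal_scaler : forall m n a, f m (n <*: a) = f m n * a
}.

(* The image of the homomorphism on the tensor product: finite sums of values
   at pure tensors. *)
Definition trace_ideal (A : pzRingType) (M N : Type) (f : M -> N -> A) : set A :=
  [set a | exists s : seq (M * N), a = \sum_(p <- s) f p.1 p.2].

Record morita_context (A B : pzRingType)
    (M : bimodule A B) (N : bimodule B A) := MoritaContext {
  mc_phi : M -> N -> A;
  mc_psi : N -> M -> B;
  mc_phi_bal : balanced_bilinear mc_phi;
  mc_psi_bal : balanced_bilinear mc_psi;
  mc_assocM : forall m n m', m <*: mc_psi n m' = mc_phi m n *: m';
  mc_assocN : forall n m n', n <*: mc_phi m n' = mc_psi n m *: n'
}.

Record morita_ring (A B : pzRingType) (M : bimodule A B) (N : bimodule B A)
    (C : morita_context M N) := MoritaMx {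
  mxul : A; mxur : M; mxdl : N; mxdr : B
}.

Section MoritaRing.
Variables (A B : pzRingType) (M : bimodule A B) (N : bimodule B A).
Variable C : morita_context M N.
Notation R := (morita_ring C).
Notation mx := (MoritaMx C).
Notation phi := (mc_phi C).
Notation psi := (mc_psi C).

Definition morita_tuple (x : R) : A * M * N * B :=
  (mxul x, mxur x, mxdl x, mxdr x).
Definition morita_untuple (t : A * M * N * B) : R :=
  let: (a, m, n, b) := t in mx a m n b.
Lemma morita_tupleK : cancel morita_tuple morita_untuple.
Proof. by case. Qed.

HB.instance Definition _ := Equality.copy R (can_type morita_tupleK).
HB.instance Definition _ := Choice.copy R (can_type morita_tupleK).

Definition morita_zero : R := mx 0 0 0 0.
Definition morita_opp (x : R) : R :=
  mx (- mxul x) (- mxur x) (- mxdl x) (- mxdr x).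
Definition morita_add (x y : R) : R :=
  mx (mxul x + mxul y) (mxur x + mxur y) (mxdl x + mxdl y) (mxdr x + mxdr y).
Definition morita_one : R := mx 1 0 0 1.
Definition morita_mul (x y : R) : R :=
  mx (mxul x * mxul y + phi (mxur x) (mxdl y))
     (mxul x *: mxur y + mxur x <*: mxdr y)
     (mxdl x <*: mxul y + mxdr x *: mxdl y)
     (psi (mxdl x) (mxur y) + mxdr x * mxdr y).

Lemma morita_addA : associative morita_add.
Proof. by move=> x y z; congr MoritaMx; rewrite /= addrA. Qed.
Lemma morita_addC : commutative morita_add.
Proof. by move=> x y; congr MoritaMx; rewrite /= addrC. Qed.
Lemma morita_add0 : left_id morita_zero morita_add.
Proof. by case=> *; congr MoritaMx; rewrite /= add0r. Qed.
Lemma morita_addN : left_inverse morita_zero morita_opp morita_add.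
Proof. by move=> x; congr MoritaMx; rewrite /= addNr. Qed.

HB.instance Definition _ := GRing.isZmodule.Build R
  morita_addA morita_addC morita_add0 morita_addN.

Lemma ract0l (A' B' : pzRingType) (P : bimodule A' B') (b : B') :
  (0 : P) <*: b = 0.
Proof. by apply: (addrI ((0 : P) <*: b)); rewrite -ractDl !addr0. Qed.
Lemma ract0r (A' B' : pzRingType) (P : bimodule A' B') (m : P) : m <*: 0 = 0.
Proof. by apply: (addrI (m <*: 0)); rewrite -ractDr !addr0. Qed.
Lemma bal0l (A' B' : pzRingType) (P : bimodule A' B') (Q : bimodule B' A')
  (f : P -> Q -> A') : balanced_bilinear f -> forall n, f 0 n = 0.
Proof.
by move=> h n; apply: (addrI (f 0 n)); rewrite -(bal_addl h) !addr0.
Qed.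
Lemma bal0r (A' B' : pzRingType) (P : bimodule A' B') (Q : bimodule B' A')
  (f : P -> Q -> A') : balanced_bilinear f -> forall m, f m 0 = 0.
Proof.
by move=> h m; apply: (addrI (f m 0)); rewrite -(bal_addr h) !addr0.
Qed.

Let hphi := mc_phi_bal C.
Let hpsi := mc_psi_bal C.

Lemma morita_mulA : associative morita_mul.
Proof.
case=> [a m n b] [a' m' n' b'] [a'' m'' n'' b'']; congr MoritaMx => /=.
- rewrite mulrDr mulrDl (bal_addr hphi) (bal_addl hphi) mulrA.
  by rewrite (bal_scalel hphi) (bal_scaler hphi) (bal_mid hphi) -!addrA;
     congr (_ + _); rewrite addrCA.
- rewrite scalerDr scalerDl ractDr ractDl scalerA ractZ ractA mc_assocM.
  by rewrite -!addrA; congr (_ + _); rewrite addrCA.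
- rewrite scalerDr scalerDl ractDr ractDl scalerA ractZ ractA mc_assocN.
  by rewrite -!addrA; congr (_ + _); rewrite addrCA.
- rewrite mulrDr mulrDl (bal_addr hpsi) (bal_addl hpsi) mulrA.
  by rewrite (bal_scalel hpsi) (bal_scaler hpsi) (bal_mid hpsi) -!addrA;
     congr (_ + _); rewrite addrCA.
Qed.
Lemma morita_mul1l : left_id morita_one morita_mul.
Proof.
case=> [a m n b]; congr MoritaMx;
  by rewrite /= ?(bal0l hphi) ?(bal0l hpsi) ?ract0l ?scale1r ?mul1r
     ?addr0 ?add0r.
Qed.
Lemma morita_mul1r : right_id morita_one morita_mul.
Proof.
case=> [a m n b]; congr MoritaMx;
  by rewrite /= ?(bal0r hphi) ?(bal0r hpsi) ?ract1 ?scaler0 ?mulr1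
     ?addr0 ?add0r.
Qed.
Lemma morita_mulDl : left_distributive morita_mul +%R.
Proof.
case=> [a m n b] [a' m' n' b'] [a'' m'' n'' b'']; congr MoritaMx => /=.
- by rewrite mulrDl (bal_addl hphi) addrACA.
- by rewrite scalerDl ractDl addrACA.
- by rewrite scalerDl ractDl addrACA.
- by rewrite mulrDl (bal_addl hpsi) addrACA.
Qed.
Lemma morita_mulDr : right_distributive morita_mul +%R.
Proof.
case=> [a m n b] [a' m' n' b'] [a'' m'' n'' b'']; congr MoritaMx => /=.
- by rewrite mulrDr (bal_addr hphi) addrACA.
- by rewrite scalerDr ractDr addrACA.
- by rewrite scalerDr ractDr addrACA.
- by rewrite mulrDr (bal_addr hpsi) addrACA.
Qed.

HB.instance Definition _ := GRing.Zmodule_isPzRing.Build R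
  morita_mulA morita_mul1l morita_mul1r morita_mulDl morita_mulDr.

End MoritaRing.

(* Main.v *)
Require Import Defs.
From mathcomp Require Import all_boot all_algebra.
From mathcomp Require Import boolp classical_sets.

Set Implicit Arguments.
Unset Strict Implicit.
Unset Printing Implicit Defensive.

Import GRing.Theory.
Local Open Scope ring_scope.

Local Open Scope classical_set_scope.

(** Adding an element of the Jacobson radical does not change invertibility.
    Since the trace ideals are radical, the diagonal blocks of a product in the
    Morita ring agree, modulo the radicals, with the products of the diagonal
    blocks.  Hence a matrix is invertible iff its two diagonal entries are
    (a Schur complement argument), so it lies in [Delta] iff its two diagonal
    entries do, and the condition on squares of units is checked on the
    diagonal. *)

Section RingUnits.
Variable R : pzRingType.
Implicit Types x y u v w j d : R.

Lemma units1 : units R 1.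
Proof. by exists 1; rewrite mulr1. Qed.

Lemma unitsM x y : units R x -> units R y -> units R (x * y).
Proof.
move=> [x' [xx' x'x]] [y' [yy' y'y]]; exists (y' * x'); split.
  by rewrite mulrA -(mulrA x) yy' mulr1.
by rewrite mulrA -(mulrA y') x'x mulr1.
Qed.

Lemma units_lr x v w : v * x = 1 -> x * w = 1 -> units R x.
Proof.
move=> vx xw; exists w; split=> //.
by rewrite -[w]mul1r -vx -(mulrA v) xw mulr1.
Qed.

(** An inverse of [x * y] yields a right inverse of [x], and one of [y * x] a left inverse. *)
Lemma units_of_prod x y : units R (x * y) -> units R (y * x) -> units R x.
Proof.
move=> [v [xyv _]] [w [_ wyx]].
by apply: (@units_lr x (w * y) (y * v)); rewrite -?mulrA // mulrA.
Qed.

(** By Zorn: left ideals containing [L] and avoiding 1 are closed under unions of nonempty chains.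
    One maximal among them is a maximal left ideal, since a left ideal containing 1 is
    everything. *)
Lemma maximal_left_ideal_sup (L : set R) :
  left_ideal L -> ~ L 1 -> exists2 I, maximal_left_ideal I & L `<=` I.
Proof.
move=> [L0 LD LM] L1.
(* Joining [L] to every set makes the union of the empty chain admissible. *)
pose P (X : set R) := left_ideal (L `|` X) /\ ~ (L `|` X) 1.
have [F FP Ftot|I [[Iid I1] Imax]] := @Zorn_bigcup R P.
  split; last first.
    case=> // -[X FX X1].
    by have [_] := FP X FX; apply; right.
  split; first by left.
  - move=> x y [Lx|[X FX Xx]] [Ly|[Y FY Yy]].
    + by left; apply: LD.
    + have [[_ YD _] _] := FP Y FY.
      have [|?] := YD x y (or_introl Lx) (or_intror Yy); first by left.
      by right; exists Y.
    + have [[_ XD _] _] := FP X FX.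
      have [|?] := XD x y (or_intror Xx) (or_introl Ly); first by left.
      by right; exists X.
    + have [Z [FZ Zx Zy]] : exists Z, [/\ F Z, Z x & Z y].
        by have [XY|YX] := Ftot X Y FX FY;
          [exists Y | exists X]; split=> //; [apply: XY | apply: YX].
      have [[_ ZD _] _] := FP Z FZ.
      have [|?] := ZD x y (or_intror Zx) (or_intror Zy); first by left.
      by right; exists Z.
  - move=> a x [Lx|[X FX Xx]]; first by left; apply: LM.
    have [[_ _ XM] _] := FP X FX.
    have [|?] := XM a x (or_intror Xx); first by left.
    by right; exists X.
exists (L `|` I); last by move=> x; left.
split=> //; first by move=> IT; apply: I1; rewrite IT.
move=> K Kid IK; have [K0 _ KM] := Kid.
have [K1|K1] := pselect (K 1).
  right; apply/seteqP; split=> // x _.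
  by rewrite -[x]mulr1; apply: KM.
(* A point of [K] outside [L] and [I] would make [K] an admissible set strictly larger than [I]. *)
left; apply/seteqP; split=> // x Kx; apply: contrapT => nIx.
have LK : L `|` K = K.
  by apply/seteqP; split=> y; [case=> // Ly; apply/IK; left | right].
apply: (Imax K); last by rewrite /P LK.
split; last by move=> KI; apply: nIx; right; apply: KI.
by move=> y Iy; apply: IK; right.
Qed.

Lemma jacobsonM x j : jacobson R j -> jacobson R (x * j).
Proof. by move=> Jj I Imax; have [[_ _ IM] _ _] := Imax; apply: IM (Jj I Imax). Qed.

Lemma jacobson_opp j : jacobson R j -> jacobson R (- j).
Proof. by rewrite -mulN1r; apply: jacobsonM. Qed.

(** Otherwise the left ideal generated by [1 + j] is proper and lies in a maximal one; that one also
    contains [j], hence 1. *)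
Lemma jacobson_left_inv j : jacobson R j -> exists v, v * (1 + j) = 1.
Proof.
move=> Jj; pose L : set R := [set x | exists v, x = v * (1 + j)].
have [[v v1]|L1] := pselect (L 1); first by exists v.
have Lid : left_ideal L.
  split; first by exists 0; rewrite mul0r.
  - by move=> _ _ [v ->] [w ->]; exists (v + w); rewrite mulrDl.
  - by move=> a _ [v ->]; exists (a * v); rewrite mulrA.
have [I Imax LI] := maximal_left_ideal_sup Lid L1.
have [[_ ID IM] IT _] := Imax; exfalso; apply: IT.
apply/seteqP; split=> // x _; rewrite -[x]mulr1; apply: (IM).
rewrite -[1](addrK j) -mulN1r; apply: ID; last exact: IM (Jj I Imax).
by apply: LI; exists 1; rewrite mul1r.
Qed.

Lemma units_1Djacobson j : jacobson R j -> units R (1 + j).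
Proof.
move=> Jj; have [v vj] := jacobson_left_inv Jj.
(* The left inverse [v] is itself of the form [1 + j'], hence left invertible. *)
have vE : v = 1 + - v * j by rewrite -{1}vj mulrDr mulr1 mulNr addrK.
have [w] := jacobson_left_inv (jacobsonM (- v) Jj).
rewrite -vE => wv; exists v; split=> //.
by rewrite -[1 + j]mul1r -{1}wv -(mulrA w) vj mulr1.
Qed.

Lemma units_Djacobson u j : units R u -> jacobson R j -> units R (u + j).
Proof.
move=> Uu Jj; have [v [uv _]] := Uu.
(* Factor [u + j] as [u * (1 + v * j)], where [v] is the inverse of [u]. *)
rewrite -[j]mul1r -uv -mulrA -[X in X + _]mulr1 -mulrDr.
exact: unitsM Uu (units_1Djacobson (jacobsonM v Jj)).
Qed.

Lemma units_subjacobson u j : units R (u + j) -> jacobson R j -> units R u.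
Proof.
by move=> Uuj Jj; rewrite -(addrK j u); apply: units_Djacobson (jacobson_opp Jj).
Qed.

Lemma Delta_Djacobson d j : Delta R d -> jacobson R j -> Delta R (d + j).
Proof.
by move=> Dd Jj u Uu; rewrite addrAC; apply: units_Djacobson => //; apply: Dd.
Qed.

End RingUnits.

Section MoritaUnits.
Variables (A B : pzRingType) (M : bimodule A B) (N : bimodule B A).
Variable C : morita_context M N.
Hypothesis hMN : trace_ideal (mc_phi C) `<=` jacobson A.
Hypothesis hNM : trace_ideal (mc_psi C) `<=` jacobson B.
Notation R := (morita_ring C).
Notation mx := (MoritaMx C).
Notation phi := (mc_phi C).
Notation psi := (mc_psi C).

Let hphi := mc_phi_bal C.
Let hpsi := mc_psi_bal C.

Lemma mx_mulE a m n b a' m' n' b' :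
  mx a m n b * mx a' m' n' b' =
  mx (a * a' + phi m n') (a *: m' + m <*: b')
     (n <*: a' + b *: n') (psi n m' + b * b').
Proof. by []. Qed.

Lemma jacobson_phi m n : jacobson A (phi m n).
Proof. by apply: hMN; exists [:: (m, n)]; rewrite big_seq1. Qed.

Lemma jacobson_psi n m : jacobson B (psi n m).
Proof. by apply: hNM; exists [:: (n, m)]; rewrite big_seq1. Qed.

Definition mx0E := (bal0l hphi, bal0l hpsi, bal0r hphi, bal0r hpsi,
  @ract0l, @ract0r, @ract1, @scaler0, @scale0r, @scale1r, @mulr0, @mul0r,
  @mulr1, @mul1r, @addr0, @add0r).

Lemma units_mx_diag a b : units A a -> units B b -> units R (mx a 0 0 b).
Proof.
move=> [a' [aa' a'a]] [b' [bb' b'b]].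
by exists (mx a' 0 0 b'); split; rewrite mx_mulE !mx0E ?aa' ?a'a ?bb' ?b'b.
Qed.

Lemma units_mx_upper m : units R (mx 1 m 0 1).
Proof.
by exists (mx 1 (- m) 0 1); split; rewrite mx_mulE !mx0E ?addNr ?subrr.
Qed.

Lemma units_mx_lower n : units R (mx 1 0 n 1).
Proof.
by exists (mx 1 0 (- n) 1); split; rewrite mx_mulE !mx0E ?addNr ?subrr.
Qed.

Lemma units_mx a m n b : units R (mx a m n b) <-> units A a /\ units B b.
Proof.
split=> [[[a' m' n' b'] [XY YX]]|[Ua Ub]].
  have := congr1 (@mxul _ _ _ _ _) XY; have := congr1 (@mxdr _ _ _ _ _) XY.
  have := congr1 (@mxul _ _ _ _ _) YX; have := congr1 (@mxdr _ _ _ _ _) YX.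
  (* Each diagonal entry of [XY] and [YX] equals 1 and is a product of diagonal entries plus a trace
     term. Dropping that radical term leaves a unit, so [a * a'], [a' * a], [b * b'] and [b' * b]
     are units. *)
  rewrite /= => dYX uYX dXY uXY; split.
    apply: (@units_of_prod _ a a').
      apply: (@units_subjacobson _ _ (phi m n')); last exact: jacobson_phi.
      by rewrite uXY; apply: units1.
    apply: (@units_subjacobson _ _ (phi m' n)); last exact: jacobson_phi.
    by rewrite uYX; apply: units1.
  apply: (@units_of_prod _ b b').
    apply: (@units_subjacobson _ _ (psi n m')); last exact: jacobson_psi.
    by rewrite addrC dXY; apply: units1.
  apply: (@units_subjacobson _ _ (psi n' m)); last exact: jacobson_psi.
  by rewrite addrC dYX; apply: units1.
have [a' [aa' a'a]] := Ua.
(* Block LDU factorization, with the Schur complement of [a]. *)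
have -> : mx a m n b = mx 1 0 (n <*: a') 1
    * (mx a 0 0 (b - psi n (a' *: m)) * mx 1 (a' *: m) 0 1).
  rewrite !mx_mulE !mx0E scalerA aa' scale1r -ractA a'a ract1.
  by rewrite (bal_mid hpsi) addrC subrK.
apply: unitsM; first exact: units_mx_lower.
apply: unitsM; last exact: units_mx_upper.
apply: units_mx_diag => //.
exact: units_Djacobson Ub (jacobson_opp (jacobson_psi _ _)).
Qed.

Lemma Delta_mx a m n b : Delta R (mx a m n b) <-> Delta A a /\ Delta B b.
Proof.
split=> [D|[Da Db] [a' m' n' b'] /units_mx[Ua' Ub']]; last first.
  by apply/units_mx; split; [apply: Da | apply: Db].
(* Test membership in [Delta] against the units diag(u, 1) and diag(1, u). *)
split=> u Uu.
  by have /D/units_mx[] := units_mx_diag Uu (units1 B).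
by have /D/units_mx[] := units_mx_diag (units1 A) Uu.
Qed.

End MoritaUnits.

Theorem proposition4p10 (A B : pzRingType) (M : bimodule A B) (N : bimodule B A)
    (C : morita_context M N)
    (hMN : trace_ideal (mc_phi C) `<=` jacobson A)
    (hNM : trace_ideal (mc_psi C) `<=` jacobson B) :
  two_DeltaU (morita_ring C) <-> two_DeltaU A /\ two_DeltaU B.
Proof.
have sqr_diag (x y : morita_ring C) : x ^+ 2 = 1 + y ->
    mxul x ^+ 2 + mc_phi C (mxur x) (mxdl x) = 1 + mxul y /\
    mc_psi C (mxdl x) (mxur x) + mxdr x ^+ 2 = 1 + mxdr y.
  move=> xy; have := congr1 (@mxdr _ _ _ _ _) xy.
  by have := congr1 (@mxul _ _ _ _ _) xy.
split=> [DR|[DA DB] [a m n b] /(units_mx hMN hNM)[Ua Ub]].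
  (* Embed [u] as diag(u, 1) or diag(1, u): the zero off-diagonal entries kill the trace term in the
     square. *)
  split=> u Uu.
    have /DR[[d1 m n d2] /(Delta_mx hMN hNM)[Dd1 _]] :=
      units_mx_diag C Uu (units1 B).
    move=> /sqr_diag[/=]; rewrite (bal0l (mc_phi_bal C)) addr0 => ud _.
    by exists d1.
  have /DR[[d1 m n d2] /(Delta_mx hMN hNM)[_ Dd2]] :=
    units_mx_diag C (units1 A) Uu.
  move=> /sqr_diag[/= _]; rewrite (bal0l (mc_psi_bal C)) add0r => ud.
  by exists d2.
have [d1 Dd1 a2] := DA a Ua; have [d2 Dd2 b2] := DB b Ub.
(* This is the square of the matrix minus 1, with [d1] for [a ^+ 2 - 1] and [d2] for [b ^+ 2 - 1].
   Its diagonal entries differ from [d1] and [d2] by radical elements. *)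
exists (MoritaMx C (d1 + mc_phi C m n) (a *: m + m <*: b)
                   (n <*: a + b *: n) (d2 + mc_psi C n m)).
  apply/(Delta_mx hMN hNM).
  by split; apply: Delta_Djacobson => //; [apply: jacobson_phi | apply: jacobson_psi].
rewrite expr2 mx_mulE -!expr2 a2 b2.
by congr MoritaMx => /=; rewrite ?add0r -?addrA // addrC -addrA.
Qed.
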